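(* For every $n\ge 4$, the matching polytope $P_M(W_n)$ of the wheel graph $W_n$ has the integer decomposition property.
   Context: The wheel graph $W_n$ ($n\ge4$) has vertex set $\mathbb{Z}_{n-1}\sqcup\{v\}$ and edges $\{i,i+1\}$ and $\{i,v\}$ for $i\in\mathbb{Z}_{n-1}$ (a cycle of length $n-1$ plus a central vertex joined to every cycle vertex). For a graph $G$ with edge set $E$, the matching polytope $P_M(G)\subset\mathbb{R}^E$ is the convex hull of the indicator vectors of all matchings of $G$. A lattice polytope $P\subset\mathbb{R}^d$ has the integer decomposition property if for every $t\in\mathbb{Z}_{>0}$ and every $\alpha\in tP\cap\mathbb{Z}^d$ there exist $\alpha_1,\dots,\alpha_t\in P\cap\mathbb{Z}^d$ with $\alpha=\alpha_1+\cdots+\alpha_t$. *)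

(* Defs.v *)
From HB Require Import structures.
From mathcomp Require Import all_boot all_order all_algebra.
From mathcomp Require Import boolp classical_sets reals convex.

Set Implicit Arguments.
Unset Strict Implicit.
Unset Printing Implicit Defensive.

Import Order.TTheory GRing.Theory Num.Theory.

Local Open Scope ring_scope.

Record sgraph := SGraph {
  vertex :> finType;
  adj : rel vertex;
  adj_sym : symmetric adj;
  adj_irrefl : irreflexive adj
}.

Definition edge_set (G : sgraph) : {set {set G}} :=
  [set [set x; y]%SET | x in G, y in G & adj x y]%SET.

Notation edge G := {e : {set vertex G} | e \in edge_set G}.

Definition is_matching (G : sgraph) (M : {set edge G}) : Prop :=
  {in M &, forall e f : edge G, e != f -> [disjoint val e & val f]}.

(* [Some i] is the cycle vertex i and [None] is the central vertex. *)
(* ['Z_n.-1] is the ring of integers modulo n - 1 only for n >= 3; *)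
(* [wheel n] is the wheel graph W_n for n >= 4. *)
Definition wheel_adj (n : nat) : rel (option 'Z_n.-1) := fun x y =>
  match x, y with
  | Some i, Some j => (j == i + 1) || (i == j + 1)
  | None, None => false
  | _, _ => true
  end.

Lemma wheel_adj_sym n : symmetric (@wheel_adj n).
Proof. by move=> [i|] [j|] //=; rewrite orbC. Qed.

Lemma wheel_adj_irrefl n : irreflexive (@wheel_adj n).
Proof.
by move=> [i|] //=; rewrite orbb -{1}[i]addr0 (inj_eq (addrI i)) eq_sym oner_eq0.
Qed.

Definition wheel (n : nat) : sgraph :=
  SGraph (@wheel_adj_sym n) (@wheel_adj_irrefl n).

(* [R^o] is R as a module over itself, so that [{ffun I -> R^o}] is the *)
(* R-module R^I. *)

Local Open Scope classical_set_scope.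

Definition convex_hull (R : numDomainType) (V : lmodType R) (A : set V)
  : set V := smallest (@convex_set R V) A.

Definition indicator (R : realType) (I : finType) (A : {set I})
  : {ffun I -> R^o} := [ffun i => (i \in A)%:R].

Definition matching_polytope (R : realType) (G : sgraph)
  : set {ffun edge G -> R^o} :=
  convex_hull [set indicator R M | M in [set M | @is_matching G M]].
Arguments matching_polytope R G : clear implicits.

Definition integer_points (R : realType) (I : finType)
  : set {ffun I -> R^o} := [set x | forall i, x i \is a Num.int].
Arguments integer_points R I : clear implicits.

Definition dilate (R : realType) (I : finType) (t : nat)
  (P : set {ffun I -> R^o}) : set {ffun I -> R^o} := [set t%:R *: x | x in P].

Definition integer_decomposition_property (R : realType) (I : finType)
    (P : set {ffun I -> R^o}) : Prop :=
  forall (t : nat) (alpha : {ffun I -> R^o}), (0 < t)%N ->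
    (dilate t P `&` integer_points R I) alpha ->
    exists2 a : 'I_t -> {ffun I -> R^o},
      forall k, (P `&` integer_points R I) (a k) & alpha = \sum_(k < t) a k.

(* Main.v *)
(* The edges of a colour class of the wheel are at most one spoke and a matching
   of the rim cycle avoiding its foot; call the spoke (or its absence) the type of
   the class. If [alpha] lies in the [t]-th dilate, summing a convex combination by
   types yields real amounts of each type on each rim edge. Walking round the rim,
   it is always best to use on the next edge the types whose spoke comes after an
   even number of steps, nearest first, and to use last those whose spoke comes
   after an odd number of steps, nearest last. This order is reversed by one step,
   so the partial sums along it obey a monotone recursion with integer data; a
   fixpoint above the rounded-up real partial sums gives integer amounts.
   A type with a spoke then lives on a path, where an alternating colouring
   realises its amounts. The spokeless type lives on the whole cycle; if the cycle
   is odd its total may be too large, but then every rim edge carries it, and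
   near-perfect matchings can be traded for the rim parts of the other classes. *)
Require Import Defs.
From mathcomp Require Import all_boot all_order all_algebra.
From mathcomp Require Import boolp classical_sets reals convex interval_inference.
From mathcomp Require Import zify ring lra.

Set Implicit Arguments.
Unset Strict Implicit.
Unset Printing Implicit Defensive.

Import Order.TTheory GRing.Theory Num.Theory.

Local Open Scope ring_scope.

(** * Monotone integer recursions and rounding *)

(** Iterating [Phi] from [F] gives increasing integer vectors bounded by [C]; the total gap to [C]
    falls until the iteration stops. *)
Lemma int_monotone_fixpoint (X : finType) (Phi : (X -> int) -> X -> int)
    (Inv : (X -> int) -> Prop) (C F : X -> int) :
    (forall F1 F2, (forall x, F1 x <= F2 x) -> forall x, Phi F1 x <= Phi F2 x) ->
    (forall F, Inv F -> Inv (Phi F)) -> (forall F x, Phi F x <= C x) ->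
    Inv F -> (forall x, F x <= Phi F x) ->
  exists2 F', Inv F' & (forall x, F x <= F' x) /\ (forall x, Phi F' x = F' x).
Proof.
move=> PhiM PhiI PhiC.
have [n] := ubnP (absz (\sum_x (C x - F x))); elim: n F => // n IHn F ltn FI FPhi.
have [fix_F|/forallPn/= [x0 x0P]] := boolP [forall x, Phi F x == F x].
  by exists F => //; split=> // x; apply/eqP/(forallP fix_F).
have FC x : F x <= C x := le_trans (FPhi x) (PhiC F x).
have [|F' F'I [le' fix']] := IHn (Phi F) _ (PhiI _ FI) (PhiM _ _ FPhi).
  have lt0 : \sum_x (C x - Phi F x) < \sum_x (C x - F x).
    rewrite (bigD1 x0) //= [ltRHS](bigD1 x0) //= ltr_leD //.
      by rewrite ltrD2l ltrN2 lt_neqAle eq_sym x0P FPhi.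
    by apply: ler_sum => x _; rewrite lerD2l lerN2.
  have ge0 : 0 <= \sum_x (C x - Phi F x).
    by apply: sumr_ge0 => x _; rewrite subr_ge0.
  by move: ltn lt0 ge0; lia.
by exists F' => //; split=> // x; apply: le_trans (FPhi x) (le' x).
Qed.

(** Inserting the elements of [S] in order of [key] gives a chain from the empty set to [S] along
    which [H] telescopes. *)
Lemma telescope_key (T : finType) (V : zmodType) (key : T -> nat)
    (H : {set T} -> V) (S : {set T}) : {in S &, injective key} ->
  \sum_(k in S) (H (k |: [set j in S | key j < key k]%N)
                 - H [set j in S | key j < key k]%N) = H S - H finset.set0.
Proof.
have [n] := ubnP #|S|; elim: n S => // n IHn S leS inj_key.
have [->|[x0 x0S]] := set_0Vmem S; first by rewrite big_set0 subrr.
case: (arg_maxnP key x0S) => k kS' maxk; have kS : k \in S := kS'; clear kS'.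
pose S' := S :\ k.
have low j : j \in S -> j != k -> (key j < key k)%N.
  move=> jS jk; rewrite ltn_neqAle [(_ <= _)%N]maxk // andbT.
  by apply: contra jk => /eqP /inj_key ->.
have eqS : [set j in S | key j < key k]%N = S'.
  apply/setP=> j; rewrite !inE andbC; have [->|jk] := eqVneq j k.
    by rewrite ltnn.
  by case jS: (j \in S); rewrite ?andbF // low.
rewrite (bigD1 k) //= eqS finset.setD1K //.
have ltS' : (#|S'| < n)%N by move: leS; rewrite (cardsD1 k S) kS.
have injS' : {in S' &, injective key}.
  by move=> a b /finset.setD1P[_ aS] /finset.setD1P[_ bS]; apply: inj_key.
have -> : \sum_(i in S | i != k)
    (H (i |: [set j in S | key j < key i]%N) - H [set j in S | key j < key i]%N)
    = H S' - H finset.set0; last by rewrite addrA subrK.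
rewrite -(IHn _ ltS' injS'); apply: eq_big => [i|i /andP[iS ik]].
  by rewrite !inE andbC.
suff -> : [set j in S | key j < key i]%N = [set j in S' | key j < key i]%N by [].
apply/setP=> j; rewrite !inE -andbA; have [->|//] := eqVneq j k.
by rewrite ltnNge ltnW ?andbF // low.
Qed.

(* The unknowns of the monotone recursion are the sums of [Y i] over all sets of
   types, not only over the lower sets of [key i]. Read along lower sets, a fixpoint
   [F] has increments [y i k] with [y (prv i) k + y i k <= s k], because the
   complement of a lower set at [i] is a lower set at [prv i]. *)
Lemma integral_rounding (R : archiRealFieldType) (I T : finType) (prv : I -> I)
    (act : I -> {set T}) (key : I -> T -> nat) (s : T -> nat) (c : I -> nat)
    (Y : I -> T -> R) :
    (forall i, {in act i &, injective (key i)}) ->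
    (forall i k j, k \in act i -> k \in act (prv i) -> j \in act (prv i) ->
      j != k ->
      (key (prv i) j < key (prv i) k)%N = ~~ ((j \in act i) && (key i j < key i k)%N)) ->
    (forall i k, 0 <= Y i k) -> (forall i k, k \notin act i -> Y i k = 0) ->
    (forall i k, Y (prv i) k + Y i k <= (s k)%:R) ->
    (forall i, \sum_k Y i k = (c i)%:R) ->
  exists y : I -> T -> nat,
    [/\ forall i k, k \notin act i -> y i k = 0%N,
        forall i k, (y (prv i) k + y i k <= s k)%N
      & forall i, (\sum_k y i k)%N = c i].
Proof.
move=> inj_key key_rev Y_ge0 Y_act Y_cap Y_sum.
pose X := (I * {set T})%type.
(* The capacities summed over a set [A] cap the sum at [i] by that of [s] minus the sum over [A] at
   [prv i]. Passing to the complement there makes [F] enter with a plus sign, so [Phi] is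
   monotone. *)
pose Phi (F : X -> int) (x : X) := Num.min (c x.1)%:Z
  ((\sum_(k in x.2) s k)%N%:Z - (c (prv x.1))%:Z
   + F (prv x.1, act (prv x.1) :\: x.2)).
pose Inv (F : X -> int) := forall i (A : {set T}) k, k \notin A ->
  0 <= F (i, k |: A) - F (i, A) <= (s k)%:Z.
pose G (x : X) : R := \sum_(k in x.2) Y x.1 k.
pose F0 (x : X) : int := Num.ceil (G x).
have Ys i k : Y i k <= (s k)%:R.
  by apply: le_trans (Y_cap i k); rewrite lerDr.
have [||||| F FI [leF fixF]] := @int_monotone_fixpoint X Phi Inv
    (fun x => (c x.1)%:Z) F0.
- by move=> F1 F2 le12 x; rewrite /Phi le_min !ge_min lexx /= lerD2l le12 orbT.
(* Adding [k] to [A] raises the bound by [s k], less an increment of [F] if [k] is active at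
   [prv i]; a minimum with a constant keeps increments in range. *)
- move=> F FI i A k kA; rewrite /Phi /= finset.big_setU1 //=.
  set B := act (prv i).
  have [kB|kB] := boolP (k \in B).
    have -> : B :\: A = k |: (B :\: (k |: A)).
      apply/setP=> j; rewrite !inE; have [->|] /= := eqVneq j k => //.
      by rewrite kA kB.
    have /(FI (prv i)) : k \notin B :\: (k |: A) by rewrite !inE eqxx.
    lia.
  have -> : B :\: (k |: A) = B :\: A.
    apply/setP=> j; rewrite !inE; have [->|] //= := eqVneq j k.
    by rewrite (negbTE kB) !andbF.
  lia.
- by move=> F x; rewrite /Phi ge_min lexx.
- move=> i A k kA; rewrite /F0 /G /= finset.big_setU1 //=; apply/andP; split.
    by rewrite subr_ge0 le_ceil // lerDr.
  rewrite lerBlDr; apply: (@le_trans _ _ (Num.ceil ((s k)%:R + \sum_(j in A) Y i j))).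
    by rewrite le_ceil // lerD2r.
  by rewrite ceilDzr ?natr_int // -[X in Num.ceil X]/((s k)%:Z%:~R : R) intrKceil.
(* The right-hand side is an integer, so only the unrounded [G] has to be bounded by it. *)
- move=> [i A]; rewrite /Phi /F0 /= le_min; apply/andP; split.
    rewrite ceil_le_int /G /= -[leRHS]/((c i)%:R : R) -Y_sum.
    rewrite [leRHS](bigID (mem A)) /= lerDl; exact: sumr_ge0.
  rewrite ceil_le_int !rmorphD rmorphN /=.
  set B := act (prv i) :\: A.
  have h : \sum_(k in A) Y (prv i) k + \sum_(k in B) Y (prv i) k = (c (prv i))%:R.
    rewrite -Y_sum [RHS](bigID (mem A)) /=; congr (_ + _).
    rewrite big_mkcond [RHS]big_mkcond /=; apply: eq_bigr => k _.
    rewrite !inE; case: (k \in A) => //=; case: ifPn => // /Y_act -> //.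
  have h2 : \sum_(k in A) Y (prv i) k + \sum_(k in A) Y i k <= (\sum_(k in A) s k)%N%:R.
    by rewrite natr_sum -big_split; apply: ler_sum => k _; apply: Y_cap.
  have := ceil_ge (G (prv i, B)); rewrite /G /= => h3.
  rewrite -[((\sum_(k in A) s k)%N%:Z)%:~R]/((\sum_(k in A) s k)%N%:R : R).
  rewrite -[((c (prv i))%:Z)%:~R]/((c (prv i))%:R : R); lra.
have leC x : F x <= (c x.1)%:Z by rewrite -fixF /Phi ge_min lexx.
have F1 i : F (i, act i) = (c i)%:Z.
  apply/eqP; rewrite eq_le leC /=; apply: le_trans (leF _).
  rewrite /F0 /G /= (_ : \sum_(k in act i) Y i k = (c i)%:Z%:~R) ?intrKceil //.
  rewrite -[RHS]/((c i)%:R : R) -Y_sum [RHS](bigID (mem (act i))) /=.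
  by rewrite [X in _ + X]big1 ?addr0 // => k /Y_act.
have F00 i : F (i, finset.set0) = 0.
  by rewrite -fixF /Phi /= finset.setD0 F1 big_set0; lia.
pose low i k := [set j in act i | key i j < key i k]%N.
pose d i k := F (i, k |: low i k) - F (i, low i k).
have klow i k : k \notin low i k by rewrite !inE ltnn andbF.
have d_bd i k : 0 <= d i k <= (s k)%:Z by apply: FI.
exists (fun i k => if k \in act i then `|d i k|%N else 0%N); split.
- by move=> i k /negbTE ->.
- move=> i k; have [ki|] := boolP (k \in act i); last first.
    by move: (d_bd (prv i) k); case: ifP; lia.
  have [kp|] := boolP (k \in act (prv i)); last by move: (d_bd i k); lia.
  suff : d (prv i) k + d i k <= (s k)%:Z.
    by move: (d_bd i k) (d_bd (prv i) k); lia.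
  have eB : act (prv i) :\: (k |: low i k) = low (prv i) k.
    apply/setP=> j; rewrite !inE; have [->|jk] /= := eqVneq j k.
      by rewrite ltnn andbF.
    have [jp|] := boolP (j \in act (prv i)); last by rewrite !andbF.
    by rewrite (key_rev _ _ _ ki kp jp jk) andbT.
  have eA : act (prv i) :\: low i k = k |: low (prv i) k.
    rewrite -eB; apply/setP=> j; rewrite !inE; have [->|//] /= := eqVneq j k.
    by rewrite ltnn andbF kp.
  (* Before the cut at [c i], adding [k] to [low i k] raises the bound by [s k - d (prv i) k >= 0];
     the cut can only shrink this increment. *)
  have bd := d_bd (prv i) k; rewrite [d i k]/d -(fixF (i, k |: _)) -(fixF (i, low i k)).
  rewrite /Phi /= finset.big_setU1 //= eA eB; move: bd; rewrite /d.
  lia.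
- move=> i; apply/eqP; rewrite -eqz_nat; apply/eqP; rewrite -natz natr_sum; under eq_bigr do rewrite natz.
  have := @telescope_key T int (key i) (fun A => F (i, A)) (act i) (inj_key i).
  rewrite F1 F00 subr0 => <-; rewrite [RHS]big_mkcond; apply: eq_bigr => k _.
  by case: ifP => // _; move: (d_bd i k); rewrite /d /low; lia.
Qed.

(** * Matchings of the rim cycle *)

Section Cycle.
Variable p : nat.
Notation m := p.+3.
Notation Z := 'Z_m.

Lemma val_subr1 (x : Z) : val (x - 1) = if x == 0 then m.-1 else (val x).-1.
Proof.
have E1 : (m - 1 %% m = m.-1)%N by rewrite modn_small // subn1.
rewrite /= E1 -[(Zp_trunc m).+2]/m modnDmr -val_eqE /=.
case: x => [[|v] ltv] /=; first by rewrite add0n modn_small.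
by rewrite addSnnS modnDr modn_small // ltnW.
Qed.

Lemma val_subr1_sub (i v : Z) :
  val (i - 1 - v) = if i == v then m.-1 else (val (i - v)).-1.
Proof. by rewrite addrAC val_subr1 subr_eq0. Qed.

Lemma sum_shift (y : Z -> nat) : (\sum_i y (i - 1)%R = \sum_i y i)%N.
Proof.
rewrite [RHS](reindex_inj (subIr 1)) //=.
Qed.

Definition cycle_matching (x : {ffun Z -> bool}) :=
  [forall i, ~~ (x (i - 1) && x i)].

(** For odd [m], the rim edges starting at [v + 1], [v + 3], ... cover every cycle vertex except
    [v]. *)
Definition near_perfect (v : Z) : {ffun Z -> bool} := [ffun i => odd (val (i - v))].

Lemma near_perfect_deg v i : odd m ->
  (near_perfect v (i - 1)%R + near_perfect v i = (i != v))%N.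
Proof.
move=> oddm; rewrite !ffunE val_subr1_sub; have [->|ne] := eqVneq i v.
  by rewrite subrr /= -(negbK (odd p)) -/(odd m) oddm.
have : val (i - v) != 0%N by rewrite (val_eqE (i - v) 0) subr_eq0.
by case: (val _) => //= n _; case: odd.
Qed.

Lemma near_perfect_self v : odd m ->
  near_perfect v v = false /\ near_perfect v (v - 1) = false.
Proof.
move=> /(near_perfect_deg v v).
by rewrite eqxx; do 2 case: (near_perfect v _).
Qed.

Lemma near_perfectP v : odd m -> cycle_matching (near_perfect v).
Proof.
move=> oddm; apply/forallP=> i; have := near_perfect_deg v i oddm.
by case: (i != v); do 2 case: (near_perfect v _).
Qed.

Lemma sum_near_perfect v : odd m -> ((\sum_i near_perfect v i).*2 = m.-1)%N.
Proof.
move=> oddm; rewrite -addnn -{1}sum_shift -big_split /=.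
under eq_bigr do rewrite near_perfect_deg //.
rewrite -[RHS]/(m.-1) -[X in X.-1](card_ord m) -(cardC1 v) -sum1_card.
by rewrite [RHS]big_mkcond; apply: eq_bigr => i _; rewrite inE; case: eqP.
Qed.

Lemma sum_ltn a s : (\sum_(k < s) (k < a) = minn a s)%N.
Proof. by elim: s => [|s IHs]; rewrite ?big_ord0 ?big_ord_recr /= ?IHs; lia. Qed.

(** Of [s] colours, edges at even offset from [i0] take the first [y i] and those at odd offset the
    last [y i], so neighbours never clash. Only [i0] and [i0 - 1] can have equal parity, when [m] is
    odd, and then [y i0 = 0]. *)
Lemma alternating_decomposition (y : Z -> nat) (s : nat) (i0 : Z) :
    (forall i, (y (i - 1)%R + y i <= s)%N) -> y i0 = 0%N \/ ~~ odd m ->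
  exists L : seq {ffun Z -> bool},
    [/\ size L = s, all cycle_matching L
      & forall i, (\sum_(x <- L) x i = y i)%N].
Proof.
move=> ys y0.
have disj a b k : (a + b <= s -> ~~ ((s - a <= k) && (k < b)))%N by lia.
pose col (k : 'I_s) : {ffun Z -> bool} :=
  [ffun i => if odd (val (i - i0)) then (s - y i <= k)%N else (k < y i)%N].
exists [seq col k | k <- enum 'I_s]; split.
- by rewrite size_map size_enum_ord.
- apply/allP=> _ /mapP[k _ ->]; apply/forallP=> i; rewrite !ffunE val_subr1_sub.
  move: (ys i); have [->|ne] := eqVneq i i0.
    rewrite subrr /=; case: y0 => [->|]; first by rewrite ltn0 andbF.
    by rewrite /= !negbK => ->; apply: disj.
  have : val (i - i0) != 0%N by rewrite (val_eqE (i - i0) 0) subr_eq0.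
  case: (val _) => //= n _; case: odd => /=; first exact: disj.
  by rewrite addnC andbC; apply: disj.
- move=> i; rewrite big_map big_enum /=.
  have yi : (y i <= s)%N by apply: leq_trans (ys i); rewrite leq_addl.
  under eq_bigr do rewrite ffunE.
  case: odd; last by rewrite sum_ltn; lia.
  have : (\sum_(k < s) ((s - y i <= k) + (k < s - y i)) = s)%N.
    rewrite -[RHS]card_ord -sum1_card; apply: eq_bigr => k _; lia.
  rewrite big_split /= sum_ltn (minn_idPl _) ?leq_subr // => sum_s.
  by apply/eqP; rewrite -(eqn_add2r (s - y i)) subnKC //; apply/eqP.
Qed.

(* A vector that has no zero on an odd cycle dominates every near-perfect
   matching, so one of these may be peeled off. *)
Lemma cycle_decomposition (y : Z -> nat) (s : nat) :
    (forall i, (y (i - 1)%R + y i <= s)%N) ->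
    (odd m -> (forall i, 0 < y i)%N -> ((\sum_i y i).*2 <= s * m.-1)%N) ->
  exists L : seq {ffun Z -> bool},
    [/\ size L = s, all cycle_matching L
      & forall i, (\sum_(x <- L) x i = y i)%N].
Proof.
elim: s y => [|s IHs] y ys ytot.
  by apply: (alternating_decomposition (i0 := 0)) => //; left; move: (ys 0); rewrite leqn0 addn_eq0 => /andP[_ /eqP].
have [/existsP[i0 /eqP y0]|/existsPn y_neq0] := boolP [exists i, y i == 0%N].
  by apply: (alternating_decomposition (i0 := i0)) => //; left.
have y_gt0 i : (0 < y i)%N by rewrite lt0n y_neq0.
have [oddm|] := boolP (odd m); last first.
  by move=> evm; apply: (alternating_decomposition (i0 := 0)) => //; right.
(* If every vertex had load [s.+1], twice the total would be [m * s.+1], more than [ytot] allows. A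
   vertex [v] with slack is the one to leave uncovered. *)
have [/existsP[v yv]|/existsPn nv] :=
  boolP [exists v, (y (v - 1)%R + y v <= s)%N]; last first.
  have : (\sum_(v : Z) s.+1 <= \sum_(v : Z) (y (v - 1)%R + y v))%N.
    by apply: leq_sum => v _; move: (nv v); rewrite -ltnNge.
  rewrite big_split /= sum_shift sum_nat_const card_ord -[(Zp_trunc m).+2]/m.
  by move=> /leq_trans/(_ (eq_leq (addnn _)))/leq_trans/(_ (ytot oddm y_gt0)); lia.
have ge1 i : (near_perfect v i <= y i)%N.
  by apply: leq_trans (leq_b1 _) _; rewrite y_gt0.
have [|_ _|L [szL okL sumL]] := IHs (fun i => y i - near_perfect v i)%N.
- move=> i; rewrite addnBAC // addnBA // -subnDA [X in (_ - X)%N]addnC.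
  rewrite near_perfect_deg // leq_subLR.
  by have [->|_] := eqVneq i v; [exact: yv | exact: ys].
- have := sum_near_perfect v oddm.
  have : (\sum_i (y i - near_perfect v i) + \sum_i near_perfect v i = \sum_i y i)%N.
    by rewrite -big_split; apply: eq_bigr => i _; rewrite /= subnK.
  by move: (ytot oddm y_gt0); lia.
exists (near_perfect v :: L); split; rewrite /= ?szL ?near_perfectP //.
by move=> i; rewrite big_cons sumL subnKC.
Qed.

(* A colour class is encoded by its spoke, if any, and the indicator of its rim
   edges, where rim edge [i] joins the cycle vertices [i] and [i + 1]. *)
Definition spoke_ok (k : option Z) (x : {ffun Z -> bool}) :=
  if k is Some j then ~~ x j && ~~ x (j - 1) else true.

Definition wheel_color (a : option Z * {ffun Z -> bool}) :=
  cycle_matching a.2 && spoke_ok a.1 a.2.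

(* Trading a coloured matching for the near-perfect matching with the same spoke
   lowers the total of the uncoloured part. *)
Lemma extend_decomposition (L : seq (option Z * {ffun Z -> bool}))
    (y : Z -> nat) (s : nat) :
    all wheel_color L -> all (fun a => a.1 != None) L ->
    (forall i, (y (i - 1)%R + y i <= s)%N) ->
    (odd m -> ((\sum_(a <- L) \sum_i a.2 i + \sum_i y i).*2
               <= (size L + s) * m.-1)%N) ->
  exists L' : seq (option Z * {ffun Z -> bool}),
    [/\ map fst L' = map fst L ++ nseq s None, all wheel_color L'
      & forall i, (\sum_(a <- L') a.2 i = \sum_(a <- L) a.2 i + y i)%N].
Proof.
have fstN (L' : seq {ffun Z -> bool}) :
    map fst [seq (None : option Z, x) | x <- L'] = nseq (size L') None.
  by elim: L' => //= ? ? ->.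
elim: L y => [|[k x] L IHL] y okL typL ys ytot.
  have [L' [szL' okL' sumL']] : exists L : seq {ffun Z -> bool},
      [/\ size L = s, all cycle_matching L
        & forall i, (\sum_(x <- L) x i = y i)%N].
    by apply: cycle_decomposition => // /ytot; rewrite big_nil.
  exists [seq (None, x) | x <- L']; split=> [||i].
  - by rewrite fstN szL'.
  - by rewrite all_map; apply: sub_all okL' => x xok; rewrite /wheel_color /= xok.
  - by rewrite big_map sumL' big_nil.
(* If this fails, [cycle_decomposition] applies to [y] directly; if it holds, [y] dominates every
   near-perfect matching. *)
have [ytot'|] := boolP [&& odd m, [forall i, 0 < y i] & (s * m.-1 < (\sum_i y i).*2)]%N;
    last first.
  rewrite !negb_and -leqNgt => ytot'.
  have [|L' [szL' okL' sumL']] := cycle_decomposition ys.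
    by move=> oddm /forallP y_gt0; move: ytot'; rewrite oddm y_gt0.
  exists (((k, x) :: L) ++ [seq (None, x) | x <- L']); split=> [||i].
  - by rewrite map_cat fstN szL'.
  - rewrite all_cat okL all_map; apply: sub_all okL' => z zok.
    by rewrite /wheel_color /= zok.
  - by rewrite big_cat /= big_map sumL'.
have {ytot'} [oddm /forallP y_gt0 lt_y] := and3P ytot'.
case/andP: okL => /andP[/= /forallP xok kx] okL.
case/andP: typL; case: k ytot kx => // j ytot /andP[xj xj1] _ typL.
have ge1 i : (near_perfect j i <= y i)%N by apply: leq_trans (leq_b1 _) (y_gt0 i).
have [npj npj1] := near_perfect_self j oddm.
(* The load of [y'] stays within [s]: away from [j] the gain from [x] is at most the 1 removed, and
   at [j] neither matching has an edge. *)
pose y' i := (y i + x i - near_perfect j i)%N.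
have y'E i : (y' i + near_perfect j i = y i + x i)%N.
  by rewrite subnK // (leq_trans (ge1 i)) ?leq_addr.
have [||L' [typL' okL' sumL']] := IHL y' okL typL.
- move=> i; rewrite -(leq_add2r (near_perfect j (i - 1)%R + near_perfect j i)).
  rewrite addnACA !y'E addnACA near_perfect_deg //.
  have [->|_] := eqVneq i j; first by rewrite (negbTE xj) (negbTE xj1) !addn0.
  apply: leq_add; first exact: ys.
  by move: (xok i); case: (x _); case: (x _).
- have arith (a b c d e q : nat) : (e.*2 = m.-1 -> b + e = c + d ->
    (d + a + c).*2 <= m.-1 + q -> (a + b).*2 <= q)%N by lia.
  have y'_sum :
      (\sum_i y' i + \sum_i near_perfect j i = \sum_i y i + \sum_i x i)%N.
    by rewrite -!big_split; apply: eq_bigr => i _; apply: y'E.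
  move=> _; apply: arith (sum_near_perfect j oddm) y'_sum _.
  by move: (ytot oddm); rewrite big_cons /= addSn mulSn.
exists ((Some j, near_perfect j) :: L'); split=> [||i].
- by rewrite /= typL'.
- by rewrite /= okL' /wheel_color near_perfectP //= npj npj1.
- have arith (a b c d e : nat) : (c + a = d + e -> a + (b + c) = e + b + d)%N by lia.
  by rewrite !big_cons sumL' /=; apply: arith (y'E i).
Qed.
End Cycle.

(** * Matchings of the wheel and their encoding *)

Lemma not_disjoint (T : finType) (v : T) (A B : {set T}) :
  v \in A -> v \in B -> ~~ [disjoint A & B].
Proof. by move=> vA vB; apply/pred0Pn; exists v; rewrite /= vA. Qed.

Lemma disjointI (T : finType) (A B : {set T}) :
  {in A, forall v, v \notin B} -> [disjoint A & B].
Proof. by move=> AB; apply/pred0P => v /=; apply/negP => /andP[/AB /negP]. Qed.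

Section Wheel.
Variable p : nat.
Notation m := p.+3.
Notation Z := 'Z_m.
Notation W := (wheel p.+4).

Lemma rim_subproof (i : Z) : [set Some i; Some (i + 1)]%SET \in edge_set W.
Proof. by apply/imset2P; exists (Some i) (Some (i + 1)); rewrite ?inE //= eqxx. Qed.
Definition rim (i : Z) : edge W :=
  @exist {set W} (fun e => e \in edge_set W) _ (rim_subproof i).

Lemma spoke_subproof (j : Z) : [set Some j; None]%SET \in edge_set W.
Proof. by apply/imset2P; exists (Some j) None; rewrite ?inE. Qed.
Definition spoke (j : Z) : edge W :=
  @exist {set W} (fun e => e \in edge_set W) _ (spoke_subproof j).

Lemma wheel_edgeP (e : edge W) : (exists i, e = rim i) \/ (exists j, e = spoke j).
Proof.
case: e => e eP; have /imset2P[u v _] := eP; rewrite !inE /= => uv eE.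
case: u v uv eE => [i|] [j|] //=.
- case/orP => /eqP -> eE; left; [exists i | exists j]; apply: val_inj => //=.
  by rewrite eE finset.setUC.
- by move=> _ eE; right; exists i; apply: val_inj.
- by move=> _ eE; right; exists j; apply: val_inj; rewrite /= eE finset.setUC.
Qed.

Lemma spoke_inj : injective spoke.
Proof.
move=> i j /(congr1 val) /= /setP /(_ (Some i)); rewrite !inE eqxx /=.
by rewrite orbF => /esym/eqP[].
Qed.

Lemma rim_neq_spoke i j : rim i != spoke j.
Proof.
apply/eqP => /(congr1 val) /= /setP /(_ None); by rewrite !inE eqxx orbT.
Qed.

Lemma rim_inj : injective rim.
Proof.
move=> i j /(congr1 val) /= /setP eq_ij; have := eq_ij (Some i); have := eq_ij (Some (i + 1)).
rewrite !inE !eqxx orbT /= !(inj_eq Some_inj) (inj_eq (addIr 1)).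
(* Distinct rim edges with the same ends would have them swapped, forcing [1 + 1 = 0], impossible
   modulo [m >= 3]. *)
have [//|ne] := eqVneq i j; rewrite orbF /= => /esym/eqP h1 /esym/eqP h2.
have : val (1 + 1 : Z) = 0%N by rewrite (_ : 1 + 1 = 0) //; apply: (addrI i); rewrite addrA h1 addr0 -h2.
by rewrite /= !modn_small.
Qed.

Definition color_matching (a : option Z * {ffun Z -> bool}) : {set edge W} :=
  [set e | [exists i, a.2 i && (e == rim i)]
        || [exists j, (a.1 == Some j) && (e == spoke j)]]%SET.

Lemma rim_color a i : (rim i \in color_matching a) = a.2 i.
Proof.
rewrite inE; apply/orP/idP => [[/existsP[j /andP[aj /eqP/rim_inj ->]]|]|ai] //.
  by move=> /existsP[j /andP[_]]; rewrite (negbTE (rim_neq_spoke i j)).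
by left; apply/existsP; exists i; rewrite ai eqxx.
Qed.

Lemma spoke_color a j : (spoke j \in color_matching a) = (a.1 == Some j).
Proof.
rewrite inE; apply/orP/idP => [[|/existsP[i /andP[ai /eqP/spoke_inj ->]]]|aj] //.
  by move=> /existsP[i /andP[_]]; rewrite eq_sym (negbTE (rim_neq_spoke i j)).
by right; apply/existsP; exists j; rewrite aj eqxx.
Qed.

Lemma color_matchingP a : wheel_color a -> is_matching (color_matching a).
Proof.
case: a => k x /andP[/= /forallP xok kx] e f.
have rr i j : x i -> x j -> i != j -> [disjoint val (rim i) & val (rim j)].
  move=> xi xj ij; apply: disjointI => v.
  rewrite !inE => /orP[] /eqP -> /=; rewrite negb_or !(inj_eq Some_inj).
    rewrite ij /=; apply/eqP => ij1.
    by have := xok i; rewrite xi ij1 addrK xj.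
  rewrite (inj_eq (addIr 1)) ij andbT; apply/eqP => ij1.
  by have := xok j; rewrite xj -ij1 addrK xi.
have rs i j : x i -> k == Some j -> [disjoint val (rim i) & val (spoke j)].
  move=> xi /eqP kj; move: kx; rewrite kj => /andP[xj xj1].
  apply: disjointI => v.
  rewrite !inE => /orP[] /eqP -> /=; rewrite orbF (inj_eq Some_inj).
    by apply: contraNneq xj => <-.
  by apply: contraNneq xj1 => <-; rewrite addrK.
case: (wheel_edgeP e) => [[i ->]|[i ->]]; case: (wheel_edgeP f) => [[j ->]|[j ->]];
  rewrite ?rim_color ?spoke_color /=.
- by move=> xi xj; rewrite (inj_eq rim_inj); apply: rr.
- by move=> xi kj _; apply: rs.
- by move=> ki xj _; rewrite disjoint_sym; apply: rs.
- by move=> /eqP -> /eqP[->]; rewrite eqxx.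
Qed.

Lemma matching_color (M : {set edge W}) : is_matching M ->
  exists2 a, wheel_color a & M = color_matching a.
Proof.
move=> MP.
have MN e f v : e \in M -> f \in M -> v \in val e -> v \in val f -> e = f.
  move=> eM fM ve vf; apply/eqP; apply: contraT => ef.
  by have := not_disjoint ve vf; rewrite MP.
have rM i : rim i \in M -> rim (i - 1) \in M -> False.
  move=> iM i1M; have : rim i = rim (i - 1).
    by apply: (MN _ _ (Some i)) => //; rewrite !inE ?subrK eqxx ?orbT.
  by move/rim_inj/eqP; rewrite -subr_eq0 opprB addrC subrK.
(* All spokes share the centre, so the picked one, if any, is the only one in [M]. *)
exists ([pick j | spoke j \in M], [ffun i => rim i \in M]).
  apply/andP; split.
    apply/forallP => i; rewrite !ffunE /=; apply/negP => /andP[i1M iM].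
    exact: rM iM i1M.
  rewrite /=; case: pickP => //= j jM; rewrite !ffunE.
  apply/andP; split; apply/negP => iM.
    apply: (negP (rim_neq_spoke j j)); apply/eqP.
    by apply: (MN _ _ (Some j)) => //; rewrite !inE eqxx.
  apply: (negP (rim_neq_spoke (j - 1) j)); apply/eqP.
  by apply: (MN _ _ (Some j)) => //; rewrite !inE ?subrK eqxx ?orbT.
apply/setP => e; case: (wheel_edgeP e) => [[i ->]|[j ->]].
  by rewrite rim_color ffunE.
rewrite spoke_color /=; case: pickP => [j' j'M|/(_ j) -> //].
apply/idP/eqP => [jM|[<-] //].
congr Some; apply: spoke_inj; apply: (MN _ _ None) => //; by rewrite !inE orbT.
Qed.
End Wheel.

(** * The order of the types along the rim *)

Section Types.
Variable p : nat.
Notation m := p.+3.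
Notation Z := 'Z_m.

Definition steps (i j : Z) : nat := val (j - i).

Lemma ltn_steps i j : (steps i j < m)%N.
Proof. exact: ltn_ord. Qed.

Lemma steps_inj i : injective (steps i).
Proof. by move=> j k /val_inj /subIr. Qed.

(** These are the types compatible with rim edge [i]: the spoke, if any, must avoid both its
    ends. *)
Definition rim_types (i : Z) : {set option Z} :=
  [set k | (k != Some i) && (k != Some (i + 1))]%SET.

Lemma rim_types_steps (i j : Z) : (Some j \in rim_types i) = (1 < steps i j)%N.
Proof.
rewrite inE !(inj_eq Some_inj) -!(inj_eq (@steps_inj i)) /steps subrr [i + 1]addrC addrK.
have -> : val (1 : Z) = 1%N by rewrite /= modn_small.
have -> : val (0 : Z) = 0%N by [].
by case: (val _) => [|[|v]].
Qed.

Lemma steps_pred (i j : Z) : Some j \in rim_types (i - 1) ->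
  steps i j = (steps (i - 1) j).-1.
Proof.
rewrite rim_types_steps /steps => gt1.
rewrite [j - i](_ : _ = j - (i - 1) - 1) ?val_subr1.
  by case: eqP gt1 => // ->.
by rewrite opprB addrA addrAC addrK.
Qed.

(** Even distances get increasing keys below [m], odd ones decreasing keys above [m]; the value [m]
    is left for the spokeless type. *)
Definition steps_key (d : nat) : nat := if odd d then (m.*2 - d)%N else d.

(* Types whose spoke is met after an even number of rim steps should use the rim
   first, the nearest one first; those with an odd number of steps last, the
   nearest one last. *)
Definition type_key (i : Z) (k : option Z) : nat :=
  if k is Some j then steps_key (steps i j) else m.

Lemma type_key_inj i : {in rim_types i &, injective (type_key i)}.
Proof.
move=> [j|] [k|]; rewrite ?rim_types_steps /type_key /steps_key // => hj hk.
- move=> eq_key; congr Some; apply: (@steps_inj i); move: eq_key; have := ltn_steps i j; have := ltn_steps i k.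
  by move: hj hk; move: (steps i j) (steps i k) => a b; do 2 case: ifP; lia.
- by have := ltn_steps i j; move: hj; move: (steps i _) => ?; case: ifP; lia.
- by have := ltn_steps i k; move: hk; move: (steps i _) => ?; case: ifP; lia.
Qed.

(** One step lowers each distance by one and flips its parity, which turns the order around. A type
    [j] at distance 2 from [i - 1] drops out at [i]; its key was the smallest, as the negation
    requires. *)
Lemma type_key_rev i k j : k \in rim_types i -> k \in rim_types (i - 1) ->
  j \in rim_types (i - 1) -> j != k ->
  (type_key (i - 1)%R j < type_key (i - 1)%R k)%N =
  ~~ ((j \in rim_types i) && (type_key i j < type_key i k)%N).
Proof.
case: k j => [k|] [j|] //.
- move=> ki kp jp jk; move: (ki) (kp) (jp); rewrite !rim_types_steps /type_key.
  rewrite (steps_pred kp) (steps_pred jp).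
  have : steps (i - 1) j != steps (i - 1) k by rewrite (inj_eq (@steps_inj _)).
  have := ltn_steps (i - 1) j; have := ltn_steps (i - 1) k.
  move: (steps _ j) (steps _ k) => [|[|[|a]]] [|b] //=;
    rewrite /steps_key /=; case: (odd b) => /=; rewrite ?negbK; try case: (odd a) => /=; lia.
- move=> ki kp _ _; move: (ki) (kp); rewrite !rim_types_steps /type_key (steps_pred kp).
  rewrite (_ : (None \in rim_types i)) ?inE //.
  have := ltn_steps (i - 1) k; move: (steps _ k) => [|a] //=;
    rewrite /steps_key /=; try case: (odd a) => /=; lia.
- move=> _ _ jp _; move: (jp); rewrite !rim_types_steps /type_key (steps_pred jp).
  have := ltn_steps (i - 1) j; move: (steps _ j) => [|[|[|a]]] //=;
    rewrite /steps_key /=; try case: (odd a) => /=; lia.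
Qed.

End Types.

(** * From points of the polytope to colour classes *)

Lemma sum_option (T : finType) (f : option T -> nat) :
  (\sum_k f k = f None + \sum_j f (Some j))%N.
Proof.
rewrite (bigD1 None) //=; congr (_ + _)%N.
rewrite (reindex_omap (@Some T) id) /=; last by case.
by apply: eq_bigl => j; rewrite eqxx.
Qed.

Section Polytope.
Variables (R : realType) (p : nat).
Notation m := p.+3.
Notation Z := 'Z_m.
Notation W := (wheel p.+4).

(** In a convex combination of matchings giving [x], this is the total coefficient of those of type
    [k]. *)
Definition type_weight (x : {ffun edge W -> R^o}) (k : option Z) : R :=
  if k is Some j then x (spoke j) else 1 - \sum_j x (spoke j).

(** Here [z i k] is the share of rim edge [i] carried by type [k]. The last clause is the odd-set
    inequality of the rim cycle. *)
Definition splitting (x : {ffun edge W -> R^o}) (z : Z -> option Z -> R) :=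
  [/\ forall i k, 0 <= z i k, forall i k, k \notin rim_types i -> z i k = 0,
      forall i k, z (i - 1) k + z i k <= type_weight x k,
      forall i, \sum_k z i k = x (rim i)
    & odd m -> (\sum_i x (rim i)) *+ 2 <= (m.-1)%:R].

Lemma color_splitting a : wheel_color a ->
  splitting (indicator R (color_matching a)) (fun i k => (a.2 i && (k == a.1))%:R).
Proof.
case: a => k x ok; have /andP[/= /forallP xok kx] := ok.
have rimE i : indicator R (color_matching (k, x)) (rim i) = (x i)%:R.
  by rewrite ffunE rim_color.
have wE k' : type_weight (indicator R (color_matching (k, x))) k' = (k' == k)%:R.
  case: k' => [j|] /=; first by rewrite ffunE spoke_color /= eq_sym.
  under eq_bigr do rewrite ffunE spoke_color /=.
  case: (k) => [j|]; last by rewrite big1 ?subr0.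
  rewrite (bigD1 j) //= eqxx big1 ?addr0 ?subrr // => i ij.
  by rewrite (inj_eq Some_inj) eq_sym (negbTE ij).
split=> [i k'|i k'|i k'|i|oddm] /=.
- exact: ler0n.
- rewrite inE negb_and !negbK; have [->|] := eqVneq k' k; last by rewrite andbF.
  rewrite andbT; case/orP => /eqP kE; move: kx; rewrite kE /= => /andP[h1 h2].
    by rewrite (negbTE h1).
  by move: h2; rewrite addrK => /negbTE ->.
- rewrite wE -natrD ler_nat; move: (xok i).
  by case: (x i); case: (x (i - 1)) => //=; case: eqP.
- rewrite rimE (bigD1 k) //= eqxx andbT big1 ?addr0 // => k' /negbTE ->.
  by rewrite andbF.
- under eq_bigr do rewrite rimE.
  rewrite -natr_sum -mulrnA ler_nat.
  have : (\sum_i x i + \sum_i x i <= m)%N.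
    rewrite -{1}sum_shift -big_split -[leqRHS](card_ord m) -sum1_card.
    by apply: leq_sum => i _ /=; move: (xok i); case: (x i); case: (x _).
  move: (\sum_i _)%N oddm => S; lia.
Qed.

(** No convex combination is written out: the clauses are jointly linear in [x] and [z], so the
    points with a splitting form a convex set containing the generators. *)
Lemma polytope_splitting x : matching_polytope R W x -> exists z, splitting x z.
Proof.
move: x; apply: smallest_sub => [x y l|_ [M /matching_color[a aok ->] <-]]; last first.
  by eexists; apply: color_splitting.
rewrite !inE => -[z [z0 za zw zs zo]] [z' [z'0 z'a z'w z's z'o]].
have l0 : 0 <= l%:num :> R by [].
have l1 : 0 <= 1 - l%:num :> R by rewrite subr_ge0.
rewrite -[conv _ _ _]/(l%:num *: x + (1 - l%:num) *: y : {ffun edge W -> R^o}).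
have avgE e : (l%:num *: x + (1 - l%:num) *: y : {ffun edge W -> R^o}) e
    = l%:num * x e + (1 - l%:num) * y e by rewrite !ffunE.
exists (fun i k => l%:num * z i k + (1 - l%:num) * z' i k); split.
- by move=> i k; rewrite addr_ge0 ?mulr_ge0.
- by move=> i k ki; rewrite za // z'a // !mulr0 addr0.
- move=> i k; rewrite addrACA -!mulrDr.
  have -> : type_weight (l%:num *: x + (1 - l%:num) *: y) k
      = l%:num * type_weight x k + (1 - l%:num) * type_weight y k.
    case: k => [j|] /=; first exact: avgE.
    under eq_bigr do rewrite avgE.
    by rewrite big_split -!mulr_sumr /=; ring.
  by rewrite lerD ?ler_wpM2l.
- by move=> i; rewrite avgE big_split -!mulr_sumr zs z's.
- move=> oddm; under eq_bigr do rewrite avgE.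
  rewrite big_split -!mulr_sumr /= mulrnDl -!mulrnAr.
  have -> : (m.-1)%:R = l%:num * (m.-1)%:R + (1 - l%:num) * (m.-1)%:R :> R by ring.
  by rewrite lerD ?ler_wpM2l ?zo ?z'o.
Qed.

Lemma splitting_colors (t : nat) (x : {ffun edge W -> R^o}) z : splitting x z ->
    integer_points R _ (t%:R *: x) ->
  exists2 L : seq (option Z * {ffun Z -> bool}),
    size L = t /\ all (@wheel_color p) L
    & t%:R *: x = \sum_(a <- L) indicator R (color_matching a).
Proof.
move=> [z0 za zw zs zo] intx.
have xrim0 i : 0 <= x (rim i) by rewrite -zs sumr_ge0.
have w0 k : 0 <= type_weight x k by apply: le_trans (zw 0 k); rewrite addr_ge0.
have natx e : 0 <= x e -> (Num.truncn ((t%:R *: x) e))%:R = t%:R * x e.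
  move=> xe; rewrite truncnK; first by rewrite ffunE.
  by rewrite natrEint intx ffunE mulr_ge0.
pose c i := Num.truncn ((t%:R *: x) (rim i)).
pose sp j := Num.truncn ((t%:R *: x) (spoke j)).
have cE i : (c i)%:R = t%:R * x (rim i) :> R by apply: natx.
have spE j : (sp j)%:R = t%:R * x (spoke j) :> R by apply/natx/(w0 (Some j)).
have sp_le : (\sum_j sp j <= t)%N.
  rewrite -(ler_nat R) natr_sum; under eq_bigr do rewrite spE.
  rewrite -mulr_sumr -[leRHS]mulr1 ler_wpM2l //.
  by have := w0 None; rewrite /= subr_ge0.
pose s k := if k is Some j then sp j else (t - \sum_j sp j)%N.
have sE k : (s k)%:R = t%:R * type_weight x k.
  case: k => [j|] /=; first exact: spE.
  rewrite natrB // natr_sum mulrBr mulr1 mulr_sumr; congr (_ - _).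
  by apply: eq_bigr => j _; rewrite spE.
have [||||||y [ya ys yc]] := @integral_rounding R Z (option Z) (fun i => i - 1) (@rim_types p)
    (@type_key p) s c (fun i k => t%:R * z i k).
- by move=> i; apply: type_key_inj.
- by move=> i k j; apply: type_key_rev.
- by move=> i k; rewrite mulr_ge0.
- by move=> i k ki; rewrite za // mulr0.
- by move=> i k; rewrite -mulrDr sE ler_wpM2l.
- by move=> i; rewrite -mulr_sumr zs cE.
(* Both rim edges at [j] carry nothing of type [Some j]: this opens the cycle for the alternating
   colouring and yields [spoke_ok]. *)
have yself j : y j (Some j) = 0%N by apply: ya; rewrite inE eqxx.
have yself1 j : y (j - 1) (Some j) = 0%N by apply: ya; rewrite inE subrK eqxx andbF.
have /choice[Ls LsP] : forall j, exists L : seq {ffun Z -> bool},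
    [/\ size L = sp j, all (@cycle_matching p) L
      & forall i, (\sum_(x <- L) x i = y i (Some j))%N].
  move=> j; apply: (alternating_decomposition (i0 := j)); last by left.
  by move=> i; apply: (ys i (Some j)).
pose L := flatten [seq [seq (Some j, x) | x <- Ls j] | j <- enum Z].
have sumL (f : option Z * {ffun Z -> bool} -> nat) :
    (\sum_(a <- L) f a = \sum_j \sum_(x <- Ls j) f (Some j, x))%N.
  rewrite /L big_flatten big_map big_enum /=; apply: eq_bigr => j _.
  by rewrite big_map.
have szL : (size L = \sum_j sp j)%N.
  rewrite -sum1_size sumL; apply: eq_bigr => j _.
  by rewrite sum1_size; case: (LsP j).
have zero_in j i (a : {ffun Z -> bool}) :
    a \in Ls j -> y i (Some j) = 0%N -> ~~ a i.
  case: (LsP j) => _ _ /(_ i) <- aL /eqP; rewrite sum_nat_seq_eq0 => /allP/(_ a aL).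
  by rewrite /= eqb0.
have [||||L' [typL' okL' sumL']] := @extend_decomposition p L (y^~ None) (s None).
- apply/allP => _ /flatten_mapP[j _ /mapP[a aL ->]]; apply/andP; split=> /=.
    by case: (LsP j) => _ /allP/(_ a aL).
  by rewrite !(zero_in j _ a).
- by apply/allP => _ /flatten_mapP[j _ /mapP[a aL ->]].
- by move=> i; apply: ys.
(* Over all types the amounts add up to [\sum_i c i], so the bound is the last clause of [splitting]
   scaled by [t]. *)
- move=> oddm; rewrite sumL szL subnKC //.
  have -> : (\sum_j \sum_(x <- Ls j) \sum_i x i + \sum_i y i None = \sum_i c i)%N.
    under eq_bigr do rewrite exchange_big /=.
    rewrite exchange_big -big_split /=; apply: eq_bigr => i _.
    by rewrite addnC -yc [RHS]sum_option; congr (_ + _)%N; apply: eq_bigr => j _; case: (LsP j).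
  rewrite -(ler_nat R) -muln2 natrM natr_sum; under eq_bigr do rewrite cE.
  rewrite -mulr_sumr -mulrA natrM ler_wpM2l // mulr_natr; exact: zo.
exists L'; first split=> //.
  by rewrite -(size_map fst) typL' size_cat size_map szL size_nseq subnKC.
apply/ffunP => e; rewrite sum_ffunE; case: (wheel_edgeP e) => [[i ->]|[j ->]].
  under eq_bigr do rewrite ffunE rim_color.
  rewrite -natr_sum sumL' sumL ffunE -[LHS]cE -yc sum_option addnC.
  by congr ((_ + _)%N%:R); apply: eq_bigr => j _; case: (LsP j).
under eq_bigr do rewrite ffunE spoke_color.
rewrite -natr_sum ffunE -[LHS]spE; congr _%:R.
(* Trading may have changed the rim parts, but the list of types is known, and it alone counts the
   spokes. *)
have -> : (\sum_(a <- L') (a.1 == Some j) = \sum_(k <- map fst L') (k == Some j))%N.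
  by rewrite big_map.
rewrite typL' big_cat big_map sumL /= big_nseq iter_addn_0 addn0.
rewrite (bigD1 j) //= [X in (_ + X)%N]big1 ?addn0 => [|i /negbTE ij].
  by rewrite eqxx sum1_size; case: (LsP j).
by rewrite big1 // => a _; rewrite (inj_eq Some_inj) ij.
Qed.

End Polytope.

Theorem theorem4p10 (R : realType) (n : nat) (hn : (4 <= n)%N) :
  integer_decomposition_property (matching_polytope R (wheel n)).
Proof.
case: n hn => [|[|[|[|p]]]] // _ t alpha t0 [[x xP <-] intx].
have [z xz] := polytope_splitting xP.
have [L [szL okL] ->] := splitting_colors xz intx.
(* The default colour is never reached, since [L] has size [t]. *)
exists (fun k : 'I_t => indicator R (color_matching (nth (None, [ffun=> false]) L k))).
  move=> k; split; last by move=> e; rewrite ffunE natr_int.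
  apply: sub_gen_smallest; exists (color_matching (nth (None, [ffun=> false]) L k)) => //.
  by apply/color_matchingP/(all_nthP _ okL); rewrite szL.
by rewrite (big_nth (None, [ffun=> false])) szL big_mkord.
Qed.
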